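(* Let $I\subset\mathbb{R}$ be an open interval, let $\alpha:I\to\mathbb{D}^3$ be a unit speed dual curve with dual Frenet frame $\{T,N,B\}$, dual curvature $\kappa$ (with positive real part) and dual torsion $\tau$, and let $\beta:I\to\mathbb{D}^3$ be an involute of $\alpha$. Let $W$ and $\overline W$ be the Darboux vectors of $\alpha$ and $\beta$, let $C=W/\|W\|$ and $\overline C=\overline W/\|\overline W\|$ be the unit dual vectors in the directions of $W$ and $\overline W$, and let $\Phi$ be the dual angle between $W$ and $B$. Then $$\overline C=\frac{\Phi'}{\sqrt{\Phi'^2+\kappa^2+\tau^2}}\,N+\frac{\sqrt{\kappa^2+\tau^2}}{\sqrt{\Phi'^2+\kappa^2+\tau^2}}\,C .$$
   Context: $\mathbb{D}=\{a+\varepsilon a^*: a,a^*\in\mathbb{R}\}$, $\varepsilon^2=0$, is the commutative ring of dual numbers ($a$ is the real part, $a^*$ the dual part); for $a>0$, $\sqrt{a+\varepsilon a^*}=\sqrt a+\varepsilon a^*/(2\sqrt a)$. $\mathbb{D}^3=\{\vec a+\varepsilon\vec a^*:\vec a,\vec a^*\in\mathbb{R}^3\}$ is the corresponding $\mathbb{D}$-module, with inner product $\langle \vec a+\varepsilon\vec a^*,\vec b+\varepsilon\vec b^*\rangle=\langle\vec a,\vec b\rangle+\varepsilon(\langle\vec a,\vec b^*\rangle+\langle\vec a^*,\vec b\rangle)$, vector product $(\vec a+\varepsilon\vec a^* )\wedge(\vec b+\varepsilon\vec b^* )=\vec a\wedge\vec b+\varepsilon(\vec a\wedge\vec b^*+\vec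 a^*\wedge\vec b)$ and, when $\vec a\neq0$, norm $\|\vec a+\varepsilon\vec a^*\|=\|\vec a\|+\varepsilon\langle\vec a,\vec a^*\rangle/\|\vec a\|$. A dual curve is a map $I\to\mathbb{D}^3$ with smooth real and dual parts; derivatives in $s$ (denoted $'$) are taken in the real and dual parts separately. For a unit speed dual curve $\alpha$ ($\langle\alpha',\alpha'\rangle=1$): $T=\alpha'$, $\kappa=\|T'\|=k_1+\varepsilon k_1^*$ with $k_1>0$, $N=T'/\kappa$, $B=T\wedge N$, and $\tau=k_2+\varepsilon k_2^*$ is determined by the Frenet formulae $T'=\kappa N$, $N'=-\kappa T+\tau B$, $B'=-\tau N$. For the (not unit speed) curve $\beta$: $\overline T=\beta'/\|\beta'\|$, $\overline B=(\beta'\wedge\beta'')/\|\beta'\wedge\beta''\|$, $\overline N=\overline B\wedge\overline T$, $\overline\kappa=\|\beta'\wedge\beta''\|/\|\beta'\|^3$, $\overline\tau=\det(\beta',\beta'',\beta''')/\|\beta'\wedge\beta''\|^2$. The Darboux vectors are $W=\tau T+\kappa B$ and $\overline W=\overline\tau\,\overline T+\overline\kappa\,\overline B$. Involute: $\beta:I\to\mathbb{D}^3$ is an involute of $\alpha$ if the real part of $\beta'$ vanishes nowhere, $\beta(s)=\alpha(s)+\lambda(s)T(s)$ for some differentiable function $\lambda:I\to\mathbb{D}$, and $\langle T(s),\overline T(s)\rangle=0$ for all $s\in I$. (Then $\lambda(s)=(c_1-s)+\varepsilon c_2$ for some $c_1,c_2\in\mathbb{R}$.) The dual angle $\Phi=\varphi+\varepsilon\varphi^*$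 between $W$ and $B$ is the differentiable dual-number-valued function of $s$ with $\sin\Phi=\dfrac{\tau}{\sqrt{\kappa^2+\tau^2}}$, $\cos\Phi=\dfrac{\kappa}{\sqrt{\kappa^2+\tau^2}}$, where $\sin\Phi=\sin\varphi+\varepsilon\varphi^*\cos\varphi$ and $\cos\Phi=\cos\varphi-\varepsilon\varphi^*\sin\varphi$; $\Phi'=\varphi'+\varepsilon(\varphi^* )'$. *)

(* Defs.v *)
From HB Require Import structures.
From mathcomp Require Import all_boot all_order all_algebra.
From mathcomp Require Import ring.
From mathcomp Require Import all_classical all_reals all_analysis.
Set Implicit Arguments.
Unset Strict Implicit.
Unset Printing Implicit Defensive.
Import Order.TTheory GRing.Theory Num.Theory.
Import numFieldNormedType.Exports.
Local Open Scope classical_set_scope.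
Local Open Scope ring_scope.

(* [DualNum a b] is a + εb, with ε^2 = 0. *)
Record dualnum (R : Type) := DualNum { dreal : R ; ddual : R }.

Definition pair_of_dualnum (R : Type) (x : dualnum R) := (dreal x, ddual x).
Definition dualnum_of_pair (R : Type) (p : R * R) := DualNum p.1 p.2.

Lemma pair_of_dualnumK (R : Type) :
  cancel (@pair_of_dualnum R) (@dualnum_of_pair R).
Proof. by case. Qed.

HB.instance Definition _ (R : choiceType) :=
  Choice.copy (dualnum R) (can_type (@pair_of_dualnumK R)).

Section DualRing.
Context (R : fieldType).
Implicit Types x y z : dualnum R.

Definition dual_zero : dualnum R := DualNum 0 0.
Definition dual_one : dualnum R := DualNum 1 0.
Definition dual_opp x := DualNum (- dreal x) (- ddual x).
Definition dual_add x y := DualNum (dreal x + dreal y) (ddual x + ddual y).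
Definition dual_mul x y :=
  DualNum (dreal x * dreal y) (dreal x * ddual y + ddual x * dreal y).

Fact dual_addA : associative dual_add.
Proof. by move=> x y z; rewrite /dual_add /= !addrA. Qed.
Fact dual_addC : commutative dual_add.
Proof. by move=> x y; rewrite /dual_add [dreal x + _]addrC [ddual x + _]addrC. Qed.
Fact dual_add0 : left_id dual_zero dual_add.
Proof. by case=> a b; rewrite /dual_add /= !add0r. Qed.
Fact dual_addN : left_inverse dual_zero dual_opp dual_add.
Proof. by case=> a b; rewrite /dual_add /= !addNr. Qed.

HB.instance Definition _ := GRing.isZmodule.Build (dualnum R)
  dual_addA dual_addC dual_add0 dual_addN.

Fact dual_mulA : associative dual_mul.
Proof.
by move=> [a a'] [b b'] [c c']; rewrite /dual_mul /=; congr DualNum; ring.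
Qed.
Fact dual_mulC : commutative dual_mul.
Proof. by move=> [a a'] [b b']; rewrite /dual_mul /=; congr DualNum; ring. Qed.
Fact dual_mul1 : left_id dual_one dual_mul.
Proof. by move=> [a a']; rewrite /dual_mul /=; congr DualNum; ring. Qed.
Fact dual_mulDl : left_distributive dual_mul dual_add.
Proof.
by move=> [a a'] [b b'] [c c']; rewrite /dual_mul /dual_add /=;
  congr DualNum; ring.
Qed.
Fact dual_one_neq0 : dual_one != dual_zero.
Proof. by apply/eqP => -[] /eqP; rewrite oner_eq0. Qed.

HB.instance Definition _ := GRing.Zmodule_isComNzRing.Build (dualnum R)
  dual_mulA dual_mulC dual_mul1 dual_mulDl dual_one_neq0.

(* The invertible dual numbers are those with nonzero real part; as in every
   [unitRingType], the inverse of a non-unit is itself. *)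
Definition dual_unit : pred (dualnum R) := fun x => dreal x != 0.
Definition dual_inv x :=
  if dreal x != 0 then DualNum (dreal x)^-1 (- ddual x / dreal x ^+ 2) else x.

Fact dual_mulVx : {in dual_unit, left_inverse 1 dual_inv *%R}.
Proof.
move=> [a a'] /=; rewrite unfold_in /= => a0.
rewrite /dual_inv /= a0 [LHS]/(dual_mul _ _) /dual_mul /=.
by congr DualNum; field.
Qed.

Fact dual_unitPl x y : y * x = 1 -> dual_unit x.
Proof.
case: x y => [a a'] [b b'] [ba _]; apply/eqP => /= a0.
by move: ba; rewrite a0 mulr0 => /eqP; rewrite eq_sym oner_eq0.
Qed.

Fact dual_inv_out : {in [predC dual_unit], dual_inv =1 id}.
Proof. by move=> x; rewrite inE unfold_in /dual_inv => /negbTE ->. Qed.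

HB.instance Definition _ := GRing.ComNzRing_hasMulInverse.Build (dualnum R)
  dual_mulVx dual_unitPl dual_inv_out.

End DualRing.

Section DualFunctions.
Context (R : realType).

Definition dual_sqrt (x : dualnum R) : dualnum R :=
  DualNum (Num.sqrt (dreal x)) (ddual x / (2 * Num.sqrt (dreal x))).

Definition dual_sin (x : dualnum R) : dualnum R :=
  DualNum (sin (dreal x)) (ddual x * cos (dreal x)).

Definition dual_cos (x : dualnum R) : dualnum R :=
  DualNum (cos (dreal x)) (- (ddual x * sin (dreal x))).

End DualFunctions.

(* The module of dual vectors is ['rV[dualnum R]_3]. *)
Section DualVectors.
Context (R : realType).

Definition vreal (v : 'rV[dualnum R]_3) : 'rV[R]_3 := map_mx (@dreal R) v.
Definition vdual (v : 'rV[dualnum R]_3) : 'rV[R]_3 := map_mx (@ddual R) v.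
Definition dual_vec (a b : 'rV[R]_3) : 'rV[dualnum R]_3 :=
  map2_mx (@DualNum R) a b.

Definition dot (a b : 'rV[R]_3) : R := \sum_(i < 3) a 0 i * b 0 i.

(* The norm that the library puts on matrices is the sup norm, hence the need
   for the Euclidean one. *)
Definition enorm (a : 'rV[R]_3) : R := Num.sqrt (dot a a).

(* Component i is a_(i+1) b_(i+2) - a_(i+2) b_(i+1), with indices mod 3. *)
Definition cross (a b : 'rV[R]_3) : 'rV[R]_3 :=
  \row_(i < 3) (a 0 (i + 1) * b 0 (i + 2%:R) - a 0 (i + 2%:R) * b 0 (i + 1)).

Definition dual_dot (u v : 'rV[dualnum R]_3) : dualnum R :=
  DualNum (dot (vreal u) (vreal v))
          (dot (vreal u) (vdual v) + dot (vdual u) (vreal v)).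

Definition dual_cross (u v : 'rV[dualnum R]_3) : 'rV[dualnum R]_3 :=
  dual_vec (cross (vreal u) (vreal v))
           (cross (vreal u) (vdual v) + cross (vdual u) (vreal v)).

Definition dual_norm (u : 'rV[dualnum R]_3) : dualnum R :=
  DualNum (enorm (vreal u)) (dot (vreal u) (vdual u) / enorm (vreal u)).

Definition dual_det (u v w : 'rV[dualnum R]_3) : dualnum R :=
  \det (\matrix_(i < 3) nth 0 [:: u; v; w] i).

Definition unit_dir (u : 'rV[dualnum R]_3) : 'rV[dualnum R]_3 :=
  (dual_norm u)^-1 *: u.

End DualVectors.

(* Maps on an open interval I are represented by total functions on R, of which
   only the values on I are ever constrained. Derivatives at points of I depend
   only on these values since I is open. *)
Section DualCalculus.
Context (R : realType).

Definition dual_differentiable (I : set R) (f : R -> dualnum R) : Prop :=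
  forall s, I s -> derivable (@dreal R \o f) s 1 /\ derivable (@ddual R \o f) s 1.

Definition dual_deriv (f : R -> dualnum R) : R -> dualnum R :=
  fun s => DualNum (derive1 (@dreal R \o f) s) (derive1 (@ddual R \o f) s).

Definition dvec_deriv (v : R -> 'rV[dualnum R]_3) : R -> 'rV[dualnum R]_3 :=
  fun s => dual_vec (derive1 (@vreal R \o v) s) (derive1 (@vdual R \o v) s).

Definition smooth_on (I : set R) (f : R -> 'rV[R]_3) : Prop :=
  forall (n : nat) s, I s -> derivable (derive1n n f) s 1.

Definition dual_curve (I : set R) (alpha : R -> 'rV[dualnum R]_3) : Prop :=
  smooth_on I (@vreal R \o alpha) /\ smooth_on I (@vdual R \o alpha).

End DualCalculus.

Section UnitSpeedFrenet.
Context (R : realType) (I : set R) (alpha : R -> 'rV[dualnum R]_3).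

Definition unit_speed : Prop :=
  forall s, I s -> dual_dot (dvec_deriv alpha s) (dvec_deriv alpha s) = 1.

Definition frenet_T : R -> 'rV[dualnum R]_3 := dvec_deriv alpha.
Definition frenet_kappa (s : R) : dualnum R :=
  dual_norm (dvec_deriv frenet_T s).
Definition frenet_N (s : R) : 'rV[dualnum R]_3 :=
  (frenet_kappa s)^-1 *: dvec_deriv frenet_T s.
Definition frenet_B (s : R) : 'rV[dualnum R]_3 :=
  dual_cross (frenet_T s) (frenet_N s).

(* The torsion is the function determined by the Frenet formulae. *)
Definition is_torsion (tau : R -> dualnum R) : Prop :=
  forall s, I s ->
    [/\ dvec_deriv frenet_T s = frenet_kappa s *: frenet_N s,
        dvec_deriv frenet_N s =
          - frenet_kappa s *: frenet_T s + tau s *: frenet_B s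
      & dvec_deriv frenet_B s = - tau s *: frenet_N s].

Definition darboux (tau : R -> dualnum R) (s : R) : 'rV[dualnum R]_3 :=
  tau s *: frenet_T s + frenet_kappa s *: frenet_B s.

(* [Phi] is determined only up to a constant multiple of 2π. *)
Definition is_dual_angle (tau Phi : R -> dualnum R) : Prop :=
  dual_differentiable I Phi /\
  forall s, I s ->
    let r := dual_sqrt (frenet_kappa s ^+ 2 + tau s ^+ 2) in
    dual_sin (Phi s) = tau s / r /\ dual_cos (Phi s) = frenet_kappa s / r.

End UnitSpeedFrenet.

(* Frenet apparatus of a curve that need not have unit speed. *)
Section GeneralFrenet.
Context (R : realType) (beta : R -> 'rV[dualnum R]_3).

Let d1 := dvec_deriv beta.
Let d2 := dvec_deriv d1.
Let d3 := dvec_deriv d2.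

Definition gen_T (s : R) : 'rV[dualnum R]_3 := (dual_norm (d1 s))^-1 *: d1 s.
Definition gen_B (s : R) : 'rV[dualnum R]_3 :=
  (dual_norm (dual_cross (d1 s) (d2 s)))^-1 *: dual_cross (d1 s) (d2 s).
Definition gen_kappa (s : R) : dualnum R :=
  dual_norm (dual_cross (d1 s) (d2 s)) / dual_norm (d1 s) ^+ 3.
Definition gen_tau (s : R) : dualnum R :=
  dual_det (d1 s) (d2 s) (d3 s) / dual_norm (dual_cross (d1 s) (d2 s)) ^+ 2.

Definition gen_darboux (s : R) : 'rV[dualnum R]_3 :=
  gen_tau s *: gen_T s + gen_kappa s *: gen_B s.

End GeneralFrenet.

Definition involute (R : realType) (I : set R)
    (alpha beta : R -> 'rV[dualnum R]_3) : Prop :=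
  (forall s, I s -> vreal (dvec_deriv beta s) != 0) /\
  exists lambda : R -> dualnum R,
    [/\ dual_differentiable I lambda,
        forall s, I s -> beta s = alpha s + lambda s *: frenet_T alpha s
      & forall s, I s -> dual_dot (frenet_T alpha s) (gen_T beta s) = 0].

(* Main.v *)
(* Orthogonality forces λ' = -1, so β' = λT' = λκN, β'' = -T' + λT'', and hence
   β' ∧ β'' = λ² T' ∧ T'' = (λκ)² W and det(β', β'', β''') = (λκ)³ (κτ' - κ'τ),
   the latter by differentiating T' ∧ T'' = κ² W. Differentiating
   κ sin Φ = τ cos Φ gives κτ' - κ'τ = (κ² + τ²) Φ'. The Darboux vector of β is
   therefore (Φ' N + W) / |λκ|, whatever the sign of the real part of λ. *)

Require Import Defs.
From mathcomp Require Import all_boot all_order all_algebra.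
From mathcomp Require Import ring.
From mathcomp Require Import all_classical all_reals all_analysis.
Import Order.TTheory GRing.Theory Num.Theory.
Import numFieldNormedType.Exports.
Local Open Scope classical_set_scope.
Local Open Scope ring_scope.

(** * Dual numbers: units, positivity and square roots *)

Section DualNumbers.
Context {R : realType}.
Implicit Types x y : dualnum R.

Lemma dualnum_eq x y : dreal x = dreal y -> ddual x = ddual y -> x = y.
Proof. by case: x y => [a a'] [b b'] /= -> ->. Qed.

Lemma drealD x y : dreal (x + y) = dreal x + dreal y.
Proof. by []. Qed.
Lemma ddualD x y : ddual (x + y) = ddual x + ddual y.
Proof. by []. Qed.
Lemma drealM x y : dreal (x * y) = dreal x * dreal y.
Proof. by []. Qed.
Lemma ddualM x y : ddual (x * y) = dreal x * ddual y + ddual x * dreal y.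
Proof. by []. Qed.

Lemma drealX x n : dreal (x ^+ n) = dreal x ^+ n.
Proof. by elim: n => // n IH; rewrite !exprS drealM IH. Qed.

Lemma dual_unitE x : (x \is a GRing.unit) = (dreal x != 0).
Proof. by []. Qed.

Lemma drealV x : x \is a GRing.unit -> dreal x^-1 = (dreal x)^-1.
Proof.
move=> xU; have x0 : dreal x != 0 by rewrite -dual_unitE.
by apply: (mulfI x0); rewrite -drealM divrr // divff.
Qed.

Lemma dual_pos_unit x : 0 < dreal x -> x \is a GRing.unit.
Proof. by move=> x0; rewrite dual_unitE gt_eqF. Qed.

Lemma dreal_sqrt_gt0 x : 0 < dreal x -> 0 < dreal (dual_sqrt x).
Proof. by rewrite sqrtr_gt0. Qed.

Lemma dual_sqr_sqrt x : 0 < dreal x -> dual_sqrt x ^+ 2 = x.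
Proof.
move=> x0; have s0 : Num.sqrt (dreal x) != 0 by rewrite gt_eqF ?sqrtr_gt0.
apply: dualnum_eq; first by rewrite drealX /= sqr_sqrtr // ltW.
by rewrite expr2 ddualM /=; field.
Qed.

Lemma dual_sqrt_sqr x : 0 < dreal x -> dual_sqrt (x ^+ 2) = x.
Proof.
move=> x0; have x0' : dreal x != 0 by rewrite gt_eqF.
rewrite /dual_sqrt drealX sqrtr_sqr gtr0_norm // expr2 ddualM.
by apply: dualnum_eq => //=; field.
Qed.

Lemma dual_sqrtM x y :
  0 < dreal x -> 0 < dreal y -> dual_sqrt (x * y) = dual_sqrt x * dual_sqrt y.
Proof.
move=> x0 y0; rewrite -{1}(dual_sqr_sqrt _ x0) -{1}(dual_sqr_sqrt _ y0) -exprMn.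
by rewrite dual_sqrt_sqr // drealM mulr_gt0 // dreal_sqrt_gt0.
Qed.

(** The dual numbers have zero divisors, so the 2 is cancelled in the real and dual parts
    separately. *)
Lemma dual_double_eq0 x : x + x = 0 -> x = 0.
Proof.
case: x => a b [/eqP + /eqP +].
by rewrite -!mulr2n !mulrn_eq0 /= => /eqP -> /eqP ->.
Qed.

End DualNumbers.

(** * Dot product, cross product and determinant over a commutative ring *)

Section VectorAlgebra.
Context {A : comNzRingType}.
Implicit Types (u v w : 'rV[A]_3) (c : A).

Lemma row3P u v :
  u 0 0 = v 0 0 -> u 0 1 = v 0 1 -> u 0 2%:R = v 0 2%:R -> u = v.
Proof.
move=> e0 e1 e2; apply/rowP => -[[|[|[|//]]] p].
- by rewrite (_ : Ordinal p = 0) //; apply: val_inj.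
- by rewrite (_ : Ordinal p = 1) //; apply: val_inj.
- by rewrite (_ : Ordinal p = 2%:R) //; apply: val_inj.
Qed.

Lemma sum3E (f : 'I_3 -> A) : \sum_(i < 3) f i = f 0 + f 1 + f 2%:R.
Proof.
rewrite !big_ord_recl big_ord0 addr0 addrA.
by do 2?[congr (_ + _)]; congr (f _); apply: val_inj.
Qed.

Lemma I3E : ((0 : 'I_3) + 1 = 1) * ((0 : 'I_3) + 2%:R = 2%:R) *
  ((1 : 'I_3) + 1 = 2%:R) * ((1 : 'I_3) + 2%:R = 0) *
  ((2%:R : 'I_3) + 1 = 0) * ((2%:R : 'I_3) + 2%:R = 1).
Proof. by do !split; apply: val_inj. Qed.

(** Working over any commutative ring turns vector identities over the dual numbers into polynomial
    identities in one ring, with no splitting into real and dual parts. *)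
Definition dot3 u v : A := \sum_(i < 3) u 0 i * v 0 i.

Definition cross3 u v : 'rV[A]_3 :=
  \row_(i < 3) (u 0 (i + 1) * v 0 (i + 2%:R) - u 0 (i + 2%:R) * v 0 (i + 1)).

Definition det3 u v w : A := \det (\matrix_(i < 3) nth 0 [:: u; v; w] i).

Lemma dot3E u v :
  dot3 u v = u 0 0 * v 0 0 + u 0 1 * v 0 1 + u 0 2%:R * v 0 2%:R.
Proof. exact: sum3E. Qed.

Lemma cross3E u v i : cross3 u v 0 i =
  u 0 (i + 1) * v 0 (i + 2%:R) - u 0 (i + 2%:R) * v 0 (i + 1).
Proof. by rewrite mxE. Qed.

Lemma double_mul (a b : A) : 2%:R * a * b = b * a + a * b.
Proof. by ring. Qed.

Lemma exprM_factor (a b c : A) n : a ^+ n * (b ^+ n * c) = (a * b) ^+ n * c.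
Proof. by rewrite exprMn mulrA. Qed.

Lemma det_mx33 (M : 'M[A]_3) :
  \det M = (M 0 1 * M 1 2%:R - M 0 2%:R * M 1 1) * M 2%:R 0
    + (M 0 2%:R * M 1 0 - M 0 0 * M 1 2%:R) * M 2%:R 1
    + (M 0 0 * M 1 1 - M 0 1 * M 1 0) * M 2%:R 2%:R.
Proof.
(* Reading entries through natural-number indices lets differently built ordinals be compared by
   computation. *)
pose f (i j : nat) := M (inZp i) (inZp j).
have fE i j : M i j = f i j by rewrite /f !valZpK.
rewrite (expand_det_row _ 0) /cofactor !big_ord_recl big_ord0.
rewrite !(expand_det_row _ ord0) /cofactor !big_ord_recl !big_ord0 !det_mx11.
by rewrite !mxE !fE /= /bump !addnE /=; ring.
Qed.

Lemma det3E u v w : det3 u v w = dot3 (cross3 u v) w.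
Proof. by rewrite /det3 det_mx33 dot3E !cross3E !I3E !mxE. Qed.

Lemma dot3C u v : dot3 u v = dot3 v u.
Proof. by rewrite !dot3E; ring. Qed.

Lemma dot3Dl u v w : dot3 (u + v) w = dot3 u w + dot3 v w.
Proof. by rewrite !dot3E !mxE; ring. Qed.

Lemma dot3Zl c u v : dot3 (c *: u) v = c * dot3 u v.
Proof. by rewrite !dot3E !mxE; ring. Qed.

Lemma dot3Dr u v w : dot3 u (v + w) = dot3 u v + dot3 u w.
Proof. by rewrite !dot3E !mxE; ring. Qed.

Lemma dot3Zr c u v : dot3 u (c *: v) = c * dot3 u v.
Proof. by rewrite !dot3E !mxE; ring. Qed.

Lemma dot3_crossl u v : dot3 u (cross3 u v) = 0.
Proof. by rewrite dot3E !cross3E !I3E; ring. Qed.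

Lemma dot3_crossr u v : dot3 v (cross3 u v) = 0.
Proof. by rewrite dot3E !cross3E !I3E; ring. Qed.

Lemma dot3_cross_cross u v :
  dot3 (cross3 u v) (cross3 u v) = dot3 u u * dot3 v v - dot3 u v ^+ 2.
Proof. by rewrite !dot3E !cross3E !I3E; ring. Qed.

Lemma dot3_cross_swap u v w : dot3 (cross3 u v) w = - dot3 (cross3 u w) v.
Proof. by rewrite !dot3E !cross3E !I3E; ring. Qed.

Lemma cross3Zl c u v : cross3 (c *: u) v = c *: cross3 u v.
Proof. by apply/rowP => i; rewrite !mxE; ring. Qed.

Lemma cross3Zr c u v : cross3 u (c *: v) = c *: cross3 u v.
Proof. by apply/rowP => i; rewrite !mxE; ring. Qed.

Lemma cross3Dr u v w : cross3 u (v + w) = cross3 u v + cross3 u w.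
Proof. by apply/rowP => i; rewrite !mxE; ring. Qed.

Lemma cross3vv u : cross3 u u = 0.
Proof. by apply/rowP => i; rewrite !mxE; ring. Qed.

Lemma cross3C u v : cross3 u v = - cross3 v u.
Proof. by apply/rowP => i; rewrite !mxE; ring. Qed.

Lemma cross3_cross u v :
  cross3 v (cross3 u v) = dot3 v v *: u - dot3 u v *: v.
Proof. by apply: row3P; rewrite !mxE !dot3E !I3E; ring. Qed.

(** Here and in [cross3D_entry], the right side has the shape that the scalar product rule yields
    term by term. *)
Lemma dot3D_terms u v u' v' : dot3 u' v + dot3 u v' =
  u' 0 0 * v 0 0 + u 0 0 * v' 0 0 + (u' 0 1 * v 0 1 + u 0 1 * v' 0 1)
  + (u' 0 2%:R * v 0 2%:R + u 0 2%:R * v' 0 2%:R).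
Proof. by rewrite !dot3E; ring. Qed.

Lemma cross3D_entry u v u' v' i : (cross3 u' v + cross3 u v') 0 i =
  u' 0 (i + 1) * v 0 (i + 2%:R) + u 0 (i + 1) * v' 0 (i + 2%:R)
  - (u' 0 (i + 2%:R) * v 0 (i + 1) + u 0 (i + 2%:R) * v' 0 (i + 1)).
Proof. by rewrite mxE !cross3E; ring. Qed.

(** Meant for u = T, v = T', a = λ', b = λ: pairing β' with T leaves 1 + λ'. *)
Lemma coef_eqN1 u v a b : dot3 u u = 1 -> dot3 u v = 0 ->
  dot3 u (u + (a *: u + b *: v)) = 0 -> a = -1.
Proof.
move=> uu uv; rewrite !dot3Dr !dot3Zr uu uv mulr1 mulr0 addr0.
by move/addr0_eq.
Qed.

(** The premises are the derivatives of the involute, with c = λ and u, v, w = T', T'', T'''. The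
    u-part of d2 is parallel to d1, and the v-part of d3 is orthogonal to u ∧ v, so only the terms
    carrying c survive. *)
Lemma triple_lambda u v w c d1 d2 d3 :
  d1 = c *: u -> d2 = - u + c *: v -> d3 = - (v *+ 2) + c *: w ->
  cross3 d1 d2 = c ^+ 2 *: cross3 u v /\
  det3 d1 d2 d3 = c ^+ 3 * dot3 (cross3 u v) w.
Proof.
move=> -> -> ->; set d1' := c *: u; set d2' := - u + _.
have e : cross3 d1' d2' = c ^+ 2 *: cross3 u v.
  rewrite cross3Zl cross3Dr cross3Zr -scaleN1r cross3Zr.
  by rewrite cross3vv scaler0 add0r scalerA.
split=> //; rewrite det3E e dot3Zl dot3Dr dot3Zr -scaler_nat.
by rewrite -scaleNr dot3Zr [X in _ * X + _]dot3C dot3_crossr; ring.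
Qed.

End VectorAlgebra.

(** * Algebra of an orthonormal frame and its Darboux vector *)

Section FrenetAlgebra.
Context {A : comNzRingType}.
Variables (T N B : 'rV[A]_3) (k t : A).
(** [P] is the Frenet expression of N', and [W] is the Darboux vector. *)
Let P := - k *: T + t *: B.
Let W := t *: T + k *: B.
Hypotheses (TT : dot3 T T = 1) (NN : dot3 N N = 1)
  (TN : dot3 T N = 0) (BE : B = cross3 T N).

(** The frame is orthonormal: B = T ∧ N is orthogonal to T and N, and Lagrange's identity makes it a
    unit vector. *)
Lemma frame_dot a b c a' b' c' :
  dot3 (a *: T + b *: N + c *: B) (a' *: T + b' *: N + c' *: B) =
  a * a' + b * b' + c * c'.
Proof.
have TB : dot3 T B = 0 by rewrite BE dot3_crossl.
have NB : dot3 N B = 0 by rewrite BE dot3_crossr.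
have BB : dot3 B B = 1 by rewrite BE dot3_cross_cross TT NN TN; ring.
rewrite !dot3Dl !dot3Dr !dot3Zl !dot3Zr.
rewrite (dot3C N T) (dot3C B T) (dot3C B N) TT NN TN TB NB BB.
by ring.
Qed.

Lemma darboux_dot_self : dot3 W W = k ^+ 2 + t ^+ 2.
Proof.
have -> : W = t *: T + 0 *: N + k *: B by rewrite scale0r addr0.
by rewrite frame_dot; ring.
Qed.

Lemma normal_dot_darboux : dot3 N W = 0.
Proof.
by rewrite dot3Dr !dot3Zr dot3C TN BE dot3_crossr !mulr0 addr0.
Qed.

(** The factors are T' and T''. The N-part of T'' drops out, and N ∧ P = W because N ∧ T = -B and N
    ∧ B = T. *)
Lemma cross_velocity_acceleration k1 :
  cross3 (k *: N) (k1 *: N + k *: P) = k ^+ 2 *: W.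
Proof.
rewrite cross3Zl !(cross3Dr, cross3Zr) cross3vv [in X in t *: X]BE.
rewrite cross3_cross NN TN (cross3C N T) -BE /W scaler0 add0r scale1r scale0r.
by rewrite subr0 scalerA -expr2 scaleNr scalerN opprK addrC.
Qed.

(** Swapping the last two factors gives -⟨T' ∧ T''', T''⟩, so T''' itself is never expanded in the
    frame: the premise on T' ∧ T''' suffices. *)
Lemma triple_product_frenet k1 t1 T3 :
  let T1 := k *: N in
  let T2 := k1 *: N + k *: P in
  cross3 T1 T3 = (2%:R * k * k1) *: W + k ^+ 2 *: (t1 *: T + k1 *: B) ->
  dot3 (cross3 T1 T2) T3 = k ^+ 3 * (k * t1 - t * k1).
Proof.
move=> T1 T2 e.
have T2E : T2 = (- k * k) *: T + k1 *: N + (k * t) *: B.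
  by rewrite /T2 /P scalerDr !scalerA addrCA addrA [k * - k]mulrC.
have WE : W = t *: T + 0 *: N + k *: B by rewrite scale0r addr0.
have W1E : t1 *: T + k1 *: B = t1 *: T + 0 *: N + k1 *: B.
  by rewrite scale0r addr0.
rewrite dot3_cross_swap e dot3Dl !dot3Zl WE W1E T2E !frame_dot.
by ring.
Qed.

(** In the derivative of τT + κB the two N-components are τκ and -κτ. *)
Lemma cancel_normal t1 k1 :
  t1 *: T + t *: (k *: N) + (k1 *: B + k *: (- t *: N)) = t1 *: T + k1 *: B.
Proof.
rewrite addrACA scaleNr scalerN !scalerA [k * t]mulrC.
by rewrite subrr addr0.
Qed.

End FrenetAlgebra.

(** * Cancellation of units in scalar multiples and quotients *)

Section UnitScaling.
Context {A : comUnitRingType}.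
Implicit Types (u N W : 'rV[A]_3).

Lemma scale_normalize (c n : A) u :
  c \is a GRing.unit -> n \is a GRing.unit ->
  (c * n)^-1 *: (c *: u) = n^-1 *: u.
Proof. by move=> cU nU; rewrite scalerA invrM // divrK. Qed.

(* Only [m ^+ 2] and [m ^+ 4] occur once the left side is multiplied out, so
   that [m] and its absolute value [n] are interchangeable. *)
Lemma involute_darboux_scaled (m n r p : A) N W :
  n \is a GRing.unit -> r \is a GRing.unit -> n ^+ 2 = m ^+ 2 ->
  (m ^+ 3 * (r ^+ 2 * p) / (n ^+ 2 * r) ^+ 2) *: (n^-1 *: (m *: N))
  + (n ^+ 2 * r / n ^+ 3) *: ((n ^+ 2 * r)^-1 *: (m ^+ 2 *: W)) =
  n^-1 *: (p *: N + W).
Proof.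
move=> nU rU nm; have nV := divrr nU; have rV := divrr rU.
have -> : (n ^+ 2 * r)^-1 = r^-1 * n^-1 ^+ 2 by rewrite invrM ?unitrX ?exprVn.
rewrite -[(n ^+ 3)^-1]exprVn -[((n ^+ 2 * r) ^+ 2)^-1]exprVn.
have -> : (n ^+ 2 * r)^-1 = r^-1 * n^-1 ^+ 2 by rewrite invrM ?unitrX ?exprVn.
rewrite !scalerDr !scalerA; move: (n^-1) (r^-1) nV rV => i j nV rV; congr (_ *: _ + _ *: _).
  transitivity ((m ^+ 2) ^+ 2 * (r * j) ^+ 2 * i ^+ 4 * (i * p)); first by ring.
  rewrite -nm rV expr1n mulr1.
  transitivity ((n * i) ^+ 4 * (i * p)); first by ring.
  by rewrite nV expr1n mul1r.
rewrite -nm; transitivity ((n * i) ^+ 4 * (r * j) * i); first by ring.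
by rewrite nV rV expr1n !mul1r.
Qed.

Lemma normalize_combination (q r p : A) N W : r \is a GRing.unit ->
  q^-1 *: (p *: N + W) = (p / q) *: N + (r / q) *: (r^-1 *: W).
Proof.
move=> rU; rewrite scalerDr !scalerA [q^-1 * p]mulrC; congr (_ + _ *: _).
by rewrite mulrAC divrr ?mul1r.
Qed.

(** The last premise is the derivative of τ cos Φ = κ sin Φ, with sin Φ = τ/r and cos Φ = κ/r put in
    and p = Φ'. Multiplying it by r and collecting κ² + τ² gives the claim. *)
Lemma angle_derivE (k t k1 t1 r p : A) :
  r \is a GRing.unit -> r ^+ 2 = k ^+ 2 + t ^+ 2 ->
  - (t / r) * p * t + k / r * t1 = k1 * (t / r) + k * (k / r * p) ->
  k * t1 - t * k1 = r ^+ 2 * p.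
Proof.
move=> rU r2; have := divrr rU; move: r^-1 => i ri e.
have {}e : r * (- (t * i) * p * t + k * i * t1)
         - r * (k1 * (t * i) + k * (k * i * p)) = 0 by rewrite e subrr.
(* Each term of the goal is given a factor 1, then rewritten as [r * i], so that both sides become
   polynomials in [i]. *)
apply/eqP; rewrite -subr_eq0 -e r2 -[k * t1]mul1r -[t * k1]mul1r.
rewrite -[X in _ - X == _]mul1r -ri; apply/eqP; ring.
Qed.

End UnitScaling.

(** * Dual vectors: products, norm and direction *)

Section DualVectorAlgebra.
Context {R : realType}.
Implicit Types (u v w : 'rV[dualnum R]_3) (c : dualnum R).

Lemma dual_dotE u v : dual_dot u v = dot3 u v.
Proof.
rewrite dot3E /dual_dot /dot !sum3E !mxE; apply: dualnum_eq; first by [].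
by rewrite !ddualD !ddualM /=; ring.
Qed.

Lemma dual_crossE u v : dual_cross u v = cross3 u v.
Proof.
apply/rowP => i; rewrite cross3E /dual_cross /dual_vec /cross !mxE.
apply: dualnum_eq; first by [].
by rewrite ddualD /=; ring.
Qed.

Lemma dual_detE u v w : dual_det u v w = det3 u v w.
Proof. by []. Qed.

(** The dual part of ⟨u, u⟩ is twice the product of the real and dual parts of u, and this 2 cancels
    the one in [dual_sqrt]. *)
Lemma dual_normE u : dual_norm u = dual_sqrt (dot3 u u).
Proof.
rewrite -dual_dotE /dual_norm /dual_sqrt /dual_dot /enorm; congr DualNum => /=.
have -> : dot (vdual u) (vreal u) = dot (vreal u) (vdual u).
  by apply: eq_bigr => i _; rewrite mulrC.
by rewrite -mulr2n -[_ *+ 2]mulr_natl -mulf_div divff ?mul1r // pnatr_eq0.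
Qed.

Lemma dot_ge0 (a : 'rV[R]_3) : 0 <= dot a a.
Proof. by apply: sumr_ge0 => i _; rewrite -expr2 sqr_ge0. Qed.

Lemma dot_gt0 (a : 'rV[R]_3) : (0 < dot a a) = (a != 0).
Proof.
rewrite lt_def dot_ge0 andbT; congr (~~ _); apply/eqP/eqP => [|->].
  move=> /psumr_eq0P => a0; apply/rowP => i; rewrite mxE; apply/eqP.
  by rewrite -sqrf_eq0 expr2 a0 // => j _; rewrite -expr2 sqr_ge0.
by rewrite /dot big1 // => i _; rewrite mxE mul0r.
Qed.

Lemma dual_dot_gt0 u : vreal u != 0 -> 0 < dreal (dot3 u u).
Proof. by rewrite -dual_dotE /= dot_gt0. Qed.

Lemma dual_normZ c u : 0 < dreal c -> 0 < dreal (dot3 u u) ->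
  dual_norm (c *: u) = c * dual_norm u.
Proof.
move=> c0 u0; rewrite !dual_normE dot3Zl dot3Zr mulrA -expr2.
by rewrite dual_sqrtM ?drealX ?exprn_gt0 // dual_sqrt_sqr.
Qed.

Lemma dual_norm_gt0 u : 0 < dreal (dot3 u u) -> 0 < dreal (dual_norm u).
Proof. by move=> u0; rewrite dual_normE dreal_sqrt_gt0. Qed.

Lemma unit_dirZ c u : 0 < dreal c -> 0 < dreal (dot3 u u) ->
  unit_dir (c *: u) = unit_dir u.
Proof.
move=> c0 u0; rewrite /unit_dir dual_normZ //.
apply: scale_normalize; apply: dual_pos_unit => //; exact: dual_norm_gt0.
Qed.

(* [m = λκ] may have a negative real part, in which case the tangent of the
   involute is [- N]. *)
Lemma unit_gen_darboux (N W d1 d2 d3 : 'rV[dualnum R]_3) (m r p : dualnum R) :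
  dreal m != 0 -> 0 < dreal r ->
  dot3 N N = 1 -> dot3 N W = 0 -> dot3 W W = r ^+ 2 ->
  d1 = m *: N -> dual_cross d1 d2 = m ^+ 2 *: W ->
  dual_det d1 d2 d3 = m ^+ 3 * (r ^+ 2 * p) ->
  unit_dir
    ((dual_det d1 d2 d3 / dual_norm (dual_cross d1 d2) ^+ 2)
       *: ((dual_norm d1)^-1 *: d1)
     + (dual_norm (dual_cross d1 d2) / dual_norm d1 ^+ 3)
       *: ((dual_norm (dual_cross d1 d2))^-1 *: dual_cross d1 d2)) =
  (p / dual_sqrt (p ^+ 2 + r ^+ 2)) *: N
  + (r / dual_sqrt (p ^+ 2 + r ^+ 2)) *: unit_dir W.
Proof.
move=> m0 r0 NN NW WW e1 e2 e3.
have m20 : 0 < dreal (m ^+ 2) by rewrite drealX exprn_even_gt0.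
pose rho := dual_norm d1.
have rhoE : rho = dual_sqrt (m ^+ 2).
  by rewrite /rho dual_normE e1 dot3Zl dot3Zr NN mulr1 expr2.
have rho0 : 0 < dreal rho by rewrite rhoE dreal_sqrt_gt0.
have rho2 : rho ^+ 2 = m ^+ 2 by rewrite rhoE dual_sqr_sqrt.
have nW : dual_norm W = r by rewrite dual_normE WW dual_sqrt_sqr.
have W0 : 0 < dreal (dot3 W W) by rewrite WW drealX exprn_gt0.
have sigE : dual_norm (dual_cross d1 d2) = rho ^+ 2 * r.
  by rewrite e2 dual_normZ // nW rho2.
rewrite -/rho sigE e3 e2 e1 involute_darboux_scaled //; try exact: dual_pos_unit.
have Y0 : dot3 (p *: N + W) (p *: N + W) = p ^+ 2 + r ^+ 2.
  rewrite !dot3Dl !dot3Dr !dot3Zl !dot3Zr NN NW WW.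
  by rewrite (dot3C W) NW !mulr0 mulr1 addr0 add0r expr2.
have q0 : 0 < dreal (p ^+ 2 + r ^+ 2).
  by rewrite drealD !drealX ltr_wpDl ?sqr_ge0 ?exprn_gt0.
(* The factor [rho^-1] has positive real part and so leaves the direction of [p *: N + W]
   unchanged. *)
rewrite unit_dirZ ?Y0 //; last by rewrite drealV ?invr_gt0 //; apply: dual_pos_unit.
rewrite /unit_dir nW dual_normE Y0.
by apply: normalize_combination; apply: dual_pos_unit.
Qed.

End DualVectorAlgebra.

(** * Derivatives of dual-valued functions *)

Section DualDerivatives.
Context {R : realType}.
Implicit Types (f g : R -> dualnum R) (s : R) (d e : dualnum R).

(** [dual_deriv] is total and has a value even where no derivative exists; this relation records
    derivability along with the value. *)
Definition is_dual_deriv f s d : Prop :=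
  is_derive s 1 (@dreal R \o f) (dreal d) /\
  is_derive s 1 (@ddual R \o f) (ddual d).

Lemma dual_derivE f s d : is_dual_deriv f s d -> dual_deriv f s = d.
Proof.
by case=> [[_ e1] [_ e2]]; apply: dualnum_eq; rewrite /= derive1E ?e1 ?e2.
Qed.

Lemma dual_differentiableP (I : set R) f s :
  dual_differentiable I f -> I s -> is_dual_deriv f s (dual_deriv f s).
Proof.
move=> df /df [d1 d2]; split; rewrite /= derive1E.
  exact: derivableP d1.
exact: derivableP d2.
Qed.

Lemma is_dual_deriv_unique f s d e :
  is_dual_deriv f s d -> is_dual_deriv f s e -> d = e.
Proof. by move=> /dual_derivE <- /dual_derivE. Qed.

Lemma is_dual_derivD f g s d e : is_dual_deriv f s d -> is_dual_deriv g s e ->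
  is_dual_deriv (fun x => f x + g x) s (d + e).
Proof.
move=> [f1 f2] [g1 g2]; split.
  exact: (@is_deriveD _ _ _ (@dreal R \o f) (@dreal R \o g)).
exact: (@is_deriveD _ _ _ (@ddual R \o f) (@ddual R \o g)).
Qed.

Lemma is_dual_derivN f s d : is_dual_deriv f s d ->
  is_dual_deriv (fun x => - f x) s (- d).
Proof.
move=> [f1 f2]; split.
  exact: (@is_deriveN _ _ _ (@dreal R \o f)).
exact: (@is_deriveN _ _ _ (@ddual R \o f)).
Qed.

Lemma is_dual_derivM f g s d e : is_dual_deriv f s d -> is_dual_deriv g s e ->
  is_dual_deriv (fun x => f x * g x) s (d * g s + f s * e).
Proof.
move=> [f1 f2] [g1 g2]; split.
  have := @is_deriveM _ _ (@dreal R \o f) (@dreal R \o g) s 1 _ _ f1 g1.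
  move=> h; apply: (is_derive_eq h); rewrite !(drealD, drealM) /= /GRing.scale /=; ring.
have h1 := @is_deriveM _ _ (@dreal R \o f) (@ddual R \o g) s 1 _ _ f1 g2.
have h2 := @is_deriveM _ _ (@ddual R \o f) (@dreal R \o g) s 1 _ _ f2 g1.
have := @is_deriveD _ _ _ _ _ s 1 _ _ h1 h2.
move=> h; apply: (is_derive_eq h); rewrite !(ddualD, ddualM) /= /GRing.scale /=; ring.
Qed.

Lemma near_eq_is_dual_deriv f g s d : (\near s, f s = g s) ->
  is_dual_deriv f s d -> is_dual_deriv g s d.
Proof.
move=> fg [f1 f2]; split.
  by apply: near_eq_is_derive f1; apply: filterS fg => x /= ->.
by apply: near_eq_is_derive f2; apply: filterS fg => x /= ->.
Qed.

Lemma is_dual_deriv_sin f s d : is_dual_deriv f s d ->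
  is_dual_deriv (fun x => dual_sin (f x)) s (dual_cos (f s) * d).
Proof.
move=> [f1 f2].
have hs := @is_derive1_comp _ sin (@dreal R \o f) s _ _ (is_derive_sin _) f1.
have hc := @is_derive1_comp _ cos (@dreal R \o f) s _ _ (is_derive_cos _) f1.
split; first by apply: (is_derive_eq hs); rewrite /= mulrC.
have h := @is_deriveM _ _ (@ddual R \o f) (cos \o (@dreal R \o f)) s 1 _ _ f2 hc.
by apply: (is_derive_eq h); rewrite ddualM /= /GRing.scale /=; ring.
Qed.

Lemma is_dual_deriv_cos f s d : is_dual_deriv f s d ->
  is_dual_deriv (fun x => dual_cos (f x)) s (- dual_sin (f s) * d).
Proof.
move=> [f1 f2].
have hs := @is_derive1_comp _ sin (@dreal R \o f) s _ _ (is_derive_sin _) f1.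
have hc := @is_derive1_comp _ cos (@dreal R \o f) s _ _ (is_derive_cos _) f1.
split; first by apply: (is_derive_eq hc); rewrite /= mulrC.
have h := @is_deriveM _ _ (@ddual R \o f) (sin \o (@dreal R \o f)) s 1 _ _ f2 hs.
have := @is_deriveN _ _ _ _ s 1 _ h.
by move=> {}h; apply: (is_derive_eq h); rewrite ddualM /= /GRing.scale /=; ring.
Qed.

Lemma is_dual_deriv_cst c s : is_dual_deriv (fun=> c) s 0.
Proof. by split; exact: is_derive_cst. Qed.

End DualDerivatives.

(** * Differentiability of quotients and square roots on an open set *)

Section DualDifferentiable.
Context {R : realType} (I : set R) (I_open : open I).
Implicit Types (f g h : R -> dualnum R).

Lemma near_open s : I s -> \forall t \near s, I t.
Proof. by move=> Is; apply: open_nbhs_nbhs. Qed.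

Lemma dual_differentiable_is f :
  (forall s, I s -> exists d, is_dual_deriv f s d) -> dual_differentiable I f.
Proof. by move=> df s /df [d [[f1 _] [f2 _]]]; exact: conj f1 f2. Qed.

Lemma dual_differentiable_eq f g : (forall s, I s -> f s = g s) ->
  dual_differentiable I f -> dual_differentiable I g.
Proof.
move=> fg df; apply: dual_differentiable_is => s Is; exists (dual_deriv f s).
apply: near_eq_is_dual_deriv (dual_differentiableP _ _ _ df Is).
by apply: filterS (near_open _ Is) => t /fg.
Qed.

(** Solving g f = h part by part expresses both parts of f as real quotients over the real part of
    g. It serves for N through κN = T', and for τ through τ cos Φ = κ sin Φ. *)
Lemma dual_differentiable_div f g h :
  dual_differentiable I g -> dual_differentiable I h ->
  (forall s, I s -> dreal (g s) != 0) ->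
  (forall s, I s -> g s * f s = h s) -> dual_differentiable I f.
Proof.
move=> dg dh g0 gf.
pose x s := (dreal (g s))^-1 * dreal (h s).
pose y s := (dreal (g s))^-1 * (ddual (h s) - ddual (g s) * x s).
apply: (@dual_differentiable_eq (fun s => DualNum (x s) (y s))) => [s Is|].
  have gs0 := g0 _ Is; rewrite /y /x -gf // ddualM drealM.
  by apply: dualnum_eq => /=; field.
move=> s Is; have [dg1 dg2] := dg _ Is; have [dh1 dh2] := dh _ Is.
have dV := @derivableV _ _ (@dreal R \o g) s 1 (g0 _ Is) dg1.
have dx := @derivableM _ _ _ (@dreal R \o h) s 1 dV dh1.
have dy := @derivableM _ _ (@ddual R \o g) _ s 1 dg2 dx.
exact: conj dx (@derivableM _ _ _ _ s 1 dV (@derivableB _ _ _ _ _ s 1 dh2 dy)).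
Qed.

(** Positivity selects the branch f = [dual_sqrt h] and keeps the real square root away from 0. It
    serves for κ through κ² = ⟨T', T'⟩. *)
Lemma dual_differentiable_root f h :
  dual_differentiable I h ->
  (forall s, I s -> 0 < dreal (f s)) ->
  (forall s, I s -> f s ^+ 2 = h s) -> dual_differentiable I f.
Proof.
move=> dh f0 fh.
have h0 s : I s -> 0 < dreal (h s).
  by move=> Is; rewrite -fh // drealX exprn_gt0 // f0.
apply: (@dual_differentiable_eq (fun s => dual_sqrt (h s))) => [s Is|].
  by rewrite -fh // dual_sqrt_sqr // f0.
move=> s Is; have [dh1 dh2] := dh _ Is.
have [ds _] := @is_derive1_comp _ Num.sqrt (@dreal R \o h) s _ _
  (is_derive1_sqrt (h0 _ Is)) (derivableP dh1).
have dc : derivable (fun=> 2 : R) s 1 by exact: derivable_cst.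
have d2 := @derivableM _ _ _ _ s 1 dc ds.
have s0 : 2 * Num.sqrt (dreal (h s)) != 0.
  by rewrite mulf_neq0 ?pnatr_eq0 // gt_eqF // sqrtr_gt0 h0.
exact: conj ds (@derivableM _ _ _ _ s 1 dh2 (@derivableV _ _ _ s 1 s0 d2)).
Qed.

End DualDifferentiable.

(** * Derivatives of dual-vector-valued functions *)

Section VectorDerivatives.
Context {R : realType}.
Implicit Types (u v : R -> 'rV[dualnum R]_3) (f : R -> dualnum R) (s : R)
  (d e : 'rV[dualnum R]_3) (c : dualnum R).

(** The entrywise form reduces vector rules to scalar ones; [vec_derivE] and [is_vec_deriv_dvec] tie
    it to [dvec_deriv], which differentiates whole row vectors. *)
Definition is_vec_deriv v s d : Prop :=
  forall i, is_dual_deriv (fun t => v t 0 i) s (d 0 i).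

Lemma vec_derivE v s d : is_vec_deriv v s d -> dvec_deriv v s = d.
Proof.
move=> vd.
have d1 : derivable (@vreal R \o v) s 1.
  apply/derivable_mxP => i j; rewrite ord1; have [[+ _] _] := vd j.
  by apply: near_eq_derivable; near=> t; rewrite /= mxE.
have d2 : derivable (@vdual R \o v) s 1.
  apply/derivable_mxP => i j; rewrite ord1; have [_ [+ _]] := vd j.
  by apply: near_eq_derivable; near=> t; rewrite /= mxE.
apply/rowP => i; have [[_ e1] [_ e2]] := vd i.
rewrite /dvec_deriv !derive1E (derive_mx d1) (derive_mx d2) 3!mxE.
apply: dualnum_eq => /=; rewrite -?e1 -?e2; apply: near_eq_derive;
  by near=> t; rewrite /= mxE.
Unshelve. all: by end_near. Qed.

Lemma is_vec_deriv_dvec v s :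
  derivable (@vreal R \o v) s 1 -> derivable (@vdual R \o v) s 1 ->
  is_vec_deriv v s (dvec_deriv v s).
Proof.
move=> d1 d2 i.
rewrite /dvec_deriv !derive1E (derive_mx d1) (derive_mx d2) 3!mxE.
move: d1 d2 => /derivable_mxP/(_ 0 i) d1 /derivable_mxP/(_ 0 i) d2.
split; [move: d1 => /derivableP | move: d2 => /derivableP];
  by apply: near_eq_is_derive; near=> t; rewrite /= mxE.
Unshelve. all: by end_near. Qed.

Lemma differentiable_is_vec_deriv (I : set R) v s :
  (forall i, dual_differentiable I (fun t => v t 0 i)) -> I s ->
  is_vec_deriv v s (dvec_deriv v s).
Proof.
move=> dv Is.
have vd : is_vec_deriv v s (\row_i dual_deriv (fun t => v t 0 i) s).
  by move=> i; rewrite mxE; apply: dual_differentiableP (dv i) Is.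
by rewrite (vec_derivE _ _ _ vd).
Qed.

Lemma is_vec_deriv_unique v s d e :
  is_vec_deriv v s d -> is_vec_deriv v s e -> d = e.
Proof. by move=> /vec_derivE <- /vec_derivE. Qed.

Lemma near_eq_is_vec_deriv u v s d : (\near s, u s = v s) ->
  is_vec_deriv u s d -> is_vec_deriv v s d.
Proof.
move=> uv ud i; apply: near_eq_is_dual_deriv (ud i).
by apply: filterS uv => t ->.
Qed.

Lemma is_vec_derivD u v s d e : is_vec_deriv u s d -> is_vec_deriv v s e ->
  is_vec_deriv (fun t => u t + v t) s (d + e).
Proof.
move=> ud ve i; rewrite mxE.
apply: near_eq_is_dual_deriv (is_dual_derivD _ _ _ _ _ (ud i) (ve i)).
by near=> t; rewrite mxE.
Unshelve. all: by end_near. Qed.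

Lemma is_vec_derivN u s d : is_vec_deriv u s d ->
  is_vec_deriv (fun t => - u t) s (- d).
Proof.
move=> ud i; rewrite mxE.
apply: near_eq_is_dual_deriv (is_dual_derivN _ _ _ (ud i)).
by near=> t; rewrite mxE.
Unshelve. all: by end_near. Qed.

Lemma is_vec_derivZ f v s c d : is_dual_deriv f s c -> is_vec_deriv v s d ->
  is_vec_deriv (fun t => f t *: v t) s (c *: v s + f s *: d).
Proof.
move=> fc vd i.
have -> : (c *: v s + f s *: d) 0 i = c * v s 0 i + f s * d 0 i.
  by rewrite 3!mxE.
apply: near_eq_is_dual_deriv (is_dual_derivM _ _ _ _ _ fc (vd i)).
by near=> t; rewrite mxE.
Unshelve. all: by end_near. Qed.

Lemma is_dual_deriv_dot3 u v s d e : is_vec_deriv u s d -> is_vec_deriv v s e ->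
  is_dual_deriv (fun t => dot3 (u t) (v t)) s (dot3 d (v s) + dot3 (u s) e).
Proof.
move=> ud ve; rewrite dot3D_terms.
have h i := is_dual_derivM _ _ _ _ _ (ud i) (ve i).
have := is_dual_derivD _ _ _ _ _ (is_dual_derivD _ _ _ _ _ (h 0) (h 1)) (h 2%:R).
by apply: near_eq_is_dual_deriv; near=> t; rewrite dot3E.
Unshelve. all: by end_near. Qed.

Lemma is_vec_deriv_cross3 u v s d e :
  is_vec_deriv u s d -> is_vec_deriv v s e ->
  is_vec_deriv (fun t => cross3 (u t) (v t)) s
    (cross3 d (v s) + cross3 (u s) e).
Proof.
move=> ud ve i; rewrite cross3D_entry.
have h j k := is_dual_derivM _ _ _ _ _ (ud j) (ve k).
have := is_dual_derivD _ _ _ _ _ (h (i + 1) (i + 2%:R))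
  (is_dual_derivN _ _ _ (h (i + 2%:R) (i + 1))).
by apply: near_eq_is_dual_deriv; near=> t; rewrite cross3E.
Unshelve. all: by end_near. Qed.

(** Transfers smoothness, stated through [derive1n] of the two parts, to iterates of
    [dvec_deriv]. *)
Lemma iter_dvec_deriv (v : R -> 'rV[dualnum R]_3) n :
  (@vreal R \o iter n (@dvec_deriv R) v = derive1n n (@vreal R \o v)) *
  (@vdual R \o iter n (@dvec_deriv R) v = derive1n n (@vdual R \o v)).
Proof.
elim: n => // n [IH1 IH2]; rewrite !derive1nS -IH1 -IH2.
by split; apply/funext => t; apply/rowP => i; rewrite /= !mxE.
Qed.

Lemma dual_curve_is_vec_deriv (I : set R) v n s : dual_curve I v -> I s ->
  is_vec_deriv (iter n (@dvec_deriv R) v) s (iter n.+1 (@dvec_deriv R) v s).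
Proof.
move=> [v1 v2] Is; apply: is_vec_deriv_dvec; rewrite iter_dvec_deriv.
  exact: v1.
exact: v2.
Qed.

End VectorDerivatives.

(** * Frenet frame, torsion and dual angle of the curve *)

Section FrenetCurve.
Context {R : realType} (I : set R) (alpha : R -> 'rV[dualnum R]_3).
Hypotheses (I_open : open I) (alpha_curve : dual_curve I alpha)
  (alpha_unit_speed : unit_speed I alpha)
  (kappa_pos : forall s, I s -> 0 < dreal (frenet_kappa alpha s)).

Let T := frenet_T alpha.
Let T1 := dvec_deriv T.
Let T2 := dvec_deriv T1.
Let T3 := dvec_deriv T2.
Let k := frenet_kappa alpha.
Let N := frenet_N alpha.
Let B := frenet_B alpha.

(** The index counts derivatives of [alpha], and [T] is already the first. *)
Lemma is_vec_deriv_T s : I s -> is_vec_deriv T s (T1 s).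
Proof. exact: (dual_curve_is_vec_deriv _ _ 1). Qed.

Lemma is_vec_deriv_T1 s : I s -> is_vec_deriv T1 s (T2 s).
Proof. exact: (dual_curve_is_vec_deriv _ _ 2). Qed.

Lemma is_vec_deriv_T2 s : I s -> is_vec_deriv T2 s (T3 s).
Proof. exact: (dual_curve_is_vec_deriv _ _ 3). Qed.

Lemma tangent_unit s : I s -> dot3 (T s) (T s) = 1.
Proof. by move=> Is; rewrite -dual_dotE; apply: alpha_unit_speed. Qed.

(** Differentiating ⟨T, T⟩ = 1 gives ⟨T, T'⟩ twice. *)
Lemma tangent_dot_deriv s : I s -> dot3 (T s) (T1 s) = 0.
Proof.
move=> Is; apply: dual_double_eq0; rewrite {1}dot3C.
have hT := is_vec_deriv_T _ Is.
apply: is_dual_deriv_unique (is_dual_deriv_dot3 _ _ _ _ _ hT hT) _.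
apply: near_eq_is_dual_deriv (is_dual_deriv_cst 1 s).
by apply: filterS (near_open _ I_open _ Is) => t /tangent_unit ->.
Qed.

Lemma kappa_unit s : I s -> k s \is a GRing.unit.
Proof. by move=> Is; apply/dual_pos_unit/kappa_pos. Qed.

Lemma kappa_sqr s : I s -> k s ^+ 2 = dot3 (T1 s) (T1 s).
Proof.
move=> Is; have := kappa_pos _ Is.
(* A positive real square root has a positive argument, so κ > 0 makes the real part of ⟨T', T'⟩
   positive. *)
by rewrite /k /frenet_kappa dual_normE /= sqrtr_gt0 => /dual_sqr_sqrt.
Qed.

Lemma kappa_normal s : I s -> k s *: N s = T1 s.
Proof. by move=> Is; rewrite scalerA divrr ?scale1r // kappa_unit. Qed.

Lemma normal_unit s : I s -> dot3 (N s) (N s) = 1.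
Proof.
move=> Is; apply: (mulrI (unitrX 2 (kappa_unit _ Is))); rewrite mulr1.
by rewrite {1}expr2 -mulrA -dot3Zr -dot3Zl kappa_normal // kappa_sqr.
Qed.

Lemma tangent_normal s : I s -> dot3 (T s) (N s) = 0.
Proof.
move=> Is; apply: (mulrI (kappa_unit _ Is)).
by rewrite -dot3Zr kappa_normal // tangent_dot_deriv // mulr0.
Qed.

Lemma binormalE s : B s = cross3 (T s) (N s).
Proof. exact: dual_crossE. Qed.

Lemma kappa_differentiable : dual_differentiable I k.
Proof.
apply: (dual_differentiable_root _ I_open k (fun s => dot3 (T1 s) (T1 s))).
- apply: dual_differentiable_is => s /is_vec_deriv_T1 h.
  by exists (dot3 (T2 s) (T1 s) + dot3 (T1 s) (T2 s)); apply: is_dual_deriv_dot3.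
- exact: kappa_pos.
- exact: kappa_sqr.
Qed.

Lemma is_vec_deriv_normal s : I s -> is_vec_deriv N s (dvec_deriv N s).
Proof.
apply: differentiable_is_vec_deriv => i.
apply: (dual_differentiable_div _ I_open (fun t => N t 0 i) k
  (fun t => T1 t 0 i)).
- exact: kappa_differentiable.
- by apply: dual_differentiable_is => t /is_vec_deriv_T1 h; exists (T2 t 0 i).
- by move=> t It; rewrite gt_eqF // kappa_pos.
- by move=> t /kappa_normal /rowP /(_ i); rewrite [LHS]mxE.
Qed.

Variable tau : R -> dualnum R.
Hypothesis tau_torsion : is_torsion I alpha tau.

Lemma is_vec_deriv_N s : I s ->
  is_vec_deriv N s (- k s *: T s + tau s *: B s).
Proof.
by move=> Is; have [_ <- _] := tau_torsion _ Is; apply: is_vec_deriv_normal.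
Qed.

Lemma is_vec_deriv_B s : I s -> is_vec_deriv B s (- tau s *: N s).
Proof.
move=> Is; have [_ _ <-] := tau_torsion _ Is.
(* The Frenet formula supplies only the value of [dvec_deriv]; derivability of B comes from B = T ∧
   N. *)
have h := is_vec_deriv_cross3 _ _ _ _ _ (is_vec_deriv_T _ Is)
  (is_vec_deriv_normal _ Is).
have hB : \forall t \near s, cross3 (T t) (N t) = B t.
  by near=> t; rewrite binormalE.
have {}h := near_eq_is_vec_deriv _ _ _ _ hB h.
by rewrite (vec_derivE _ _ _ h).
Unshelve. all: by end_near. Qed.

Let k1 := dual_deriv k.

Lemma is_dual_deriv_kappa s : I s -> is_dual_deriv k s (k1 s).
Proof. exact/dual_differentiableP/kappa_differentiable. Qed.

Lemma T2E s : I s ->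
  T2 s = k1 s *: N s + k s *: (- k s *: T s + tau s *: B s).
Proof.
move=> Is; apply: is_vec_deriv_unique (is_vec_deriv_T1 _ Is) _.
apply: near_eq_is_vec_deriv
  (is_vec_derivZ _ _ _ _ _ (is_dual_deriv_kappa _ Is) (is_vec_deriv_N _ Is)).
by apply: filterS (near_open _ I_open _ Is) => t /kappa_normal.
Qed.

Lemma darbouxE s : darboux alpha tau s = tau s *: T s + k s *: B s.
Proof. by []. Qed.

Lemma cross_T1_T2 s : I s ->
  cross3 (T1 s) (T2 s) = k s ^+ 2 *: darboux alpha tau s.
Proof.
move=> Is; rewrite T2E // -kappa_normal // darbouxE.
apply: cross_velocity_acceleration.
- exact: normal_unit.
- exact: tangent_normal.
- exact: binormalE.
Qed.

Lemma is_vec_deriv_darboux s t1 : I s -> is_dual_deriv tau s t1 ->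
  is_vec_deriv (darboux alpha tau) s (t1 *: T s + k1 s *: B s).
Proof.
move=> Is ht.
have := is_vec_derivD _ _ _ _ _
  (is_vec_derivZ _ _ _ _ _ ht (is_vec_deriv_T _ Is))
  (is_vec_derivZ _ _ _ _ _ (is_dual_deriv_kappa _ Is) (is_vec_deriv_B _ Is)).
by rewrite -kappa_normal // cancel_normal.
Qed.

(** Both sides are the derivative of T' ∧ T'' = κ²W: on the left T'' ∧ T'' vanishes, and on the
    right W' = τ'T + κ'B. *)
Lemma cross_T1_T3 s t1 : I s -> is_dual_deriv tau s t1 ->
  cross3 (T1 s) (T3 s) = (2%:R * k s * k1 s) *: darboux alpha tau s
    + k s ^+ 2 *: (t1 *: T s + k1 s *: B s).
Proof.
move=> Is ht.
have hk := is_dual_deriv_kappa _ Is.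
have h1 := is_vec_deriv_cross3 _ _ _ _ _ (is_vec_deriv_T1 _ Is)
  (is_vec_deriv_T2 _ Is).
have h2 := is_vec_derivZ _ _ _ _ _ (is_dual_derivM _ _ _ _ _ hk hk)
  (is_vec_deriv_darboux _ _ Is ht).
have -> : 2%:R * k s * k1 s = k1 s * k s + k s * k1 s by exact: double_mul.
rewrite -[LHS]add0r -[X in X + _ = _](cross3vv (T2 s)).
apply: is_vec_deriv_unique h1 _; apply: near_eq_is_vec_deriv h2.
by apply: filterS (near_open _ I_open _ Is) => t /cross_T1_T2 ->.
Qed.

Lemma triple_T1_T2_T3 s t1 : I s -> is_dual_deriv tau s t1 ->
  dot3 (cross3 (T1 s) (T2 s)) (T3 s)
  = k s ^+ 3 * (k s * t1 - tau s * k1 s).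
Proof.
move=> Is ht; have := cross_T1_T3 _ _ Is ht.
rewrite T2E // -kappa_normal //.
exact: (triple_product_frenet _ _ _ _ _ (tangent_unit _ Is) (normal_unit _ Is)
  (tangent_normal _ Is) (binormalE s)).
Qed.

Lemma dreal_kappa_tau_gt0 s : I s -> 0 < dreal (k s ^+ 2 + tau s ^+ 2).
Proof.
by move=> Is; rewrite drealD !drealX ltr_pwDl ?sqr_ge0 ?exprn_gt0 ?kappa_pos.
Qed.

Variable Phi : R -> dualnum R.
Hypothesis Phi_angle : is_dual_angle I alpha tau Phi.

Let r s := dual_sqrt (k s ^+ 2 + tau s ^+ 2).

Let r_pos s : I s -> 0 < dreal (r s).
Proof. by move=> Is; apply/dreal_sqrt_gt0/dreal_kappa_tau_gt0. Qed.

Let is_dual_deriv_Phi s : I s -> is_dual_deriv Phi s (dual_deriv Phi s).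
Proof. by apply: dual_differentiableP; case: Phi_angle. Qed.

(** Both sides are κτ/r. Eliminating r leaves an identity that can be differentiated without
    differentiating r. *)
Lemma cos_mul_tau s : I s ->
  dual_cos (Phi s) * tau s = k s * dual_sin (Phi s).
Proof.
by move=> Is; have [-> ->] := Phi_angle.2 _ Is; rewrite mulrAC mulrA.
Qed.

(** The regularity of τ is recovered from that of Φ: cos Φ = κ/r has positive real part, so
    [cos_mul_tau] can be solved for τ. *)
Lemma tau_differentiable : dual_differentiable I tau.
Proof.
apply: (dual_differentiable_div _ I_open tau (fun s => dual_cos (Phi s))
  (fun s => k s * dual_sin (Phi s))).
- apply: dual_differentiable_is => s /is_dual_deriv_Phi /is_dual_deriv_cos h.
  by eexists; exact: h.
- apply: dual_differentiable_is => s Is; eexists.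
  apply: is_dual_derivM (is_dual_deriv_kappa _ Is) _.
  exact: is_dual_deriv_sin (is_dual_deriv_Phi _ Is).
- move=> s Is; have [_ ->] := Phi_angle.2 _ Is.
  have rU : r s \is a GRing.unit by apply/dual_pos_unit/r_pos.
  by rewrite drealM drealV // gt_eqF // divr_gt0 ?r_pos ?kappa_pos.
- exact: cos_mul_tau.
Qed.

Lemma angle_deriv s : I s ->
  k s * dual_deriv tau s - tau s * k1 s = r s ^+ 2 * dual_deriv Phi s.
Proof.
move=> Is; have hP := is_dual_deriv_Phi _ Is.
have ht := dual_differentiableP _ _ _ tau_differentiable Is.
have h1 := is_dual_derivM _ _ _ _ _ (is_dual_deriv_cos _ _ _ hP) ht.
have h2 := is_dual_derivM _ _ _ _ _ (is_dual_deriv_kappa _ Is)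
  (is_dual_deriv_sin _ _ _ hP).
have rU : r s \is a GRing.unit by apply/dual_pos_unit/r_pos.
apply: angle_derivE => //; first by apply/dual_sqr_sqrt/dreal_kappa_tau_gt0.
have [<- <-] := Phi_angle.2 _ Is.
apply: is_dual_deriv_unique h1 _; apply: near_eq_is_dual_deriv h2.
by apply: filterS (near_open _ I_open _ Is) => t /cos_mul_tau.
Qed.

End FrenetCurve.

(** * Derivatives of the involute up to third order *)

Section Involute.
Context {R : realType} (I : set R) (alpha beta : R -> 'rV[dualnum R]_3).
Hypotheses (I_open : open I) (alpha_curve : dual_curve I alpha)
  (alpha_unit_speed : unit_speed I alpha).
Variable lambda : R -> dualnum R.
Hypotheses (beta_regular : forall s, I s -> vreal (dvec_deriv beta s) != 0)
  (lambda_diff : dual_differentiable I lambda)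
  (betaE : forall s, I s -> beta s = alpha s + lambda s *: frenet_T alpha s)
  (orthogonal : forall s, I s ->
     dual_dot (frenet_T alpha s) (gen_T beta s) = 0).

Let T := frenet_T alpha.
Let T1 := dvec_deriv T.
Let T2 := dvec_deriv T1.
Let T3 := dvec_deriv T2.

Let is_vec_deriv_beta s : I s -> is_vec_deriv beta s
  (T s + (dual_deriv lambda s *: T s + lambda s *: T1 s)).
Proof.
move=> Is.
have ha := dual_curve_is_vec_deriv _ _ 0 _ alpha_curve Is.
have hT := is_vec_deriv_T _ _ alpha_curve _ Is.
have hl := dual_differentiableP _ _ _ lambda_diff Is.
apply: near_eq_is_vec_deriv
  (is_vec_derivD _ _ _ _ _ ha (is_vec_derivZ _ _ _ _ _ hl hT)).
by apply: filterS (near_open _ I_open _ Is) => t /betaE.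
Qed.

(** Regularity makes ‖β'‖ a unit, so orthogonality to the unit tangent of β passes to β' itself,
    whose T-component is 1 + λ'. *)
Lemma lambda_deriv s : I s -> dual_deriv lambda s = -1.
Proof.
move=> Is.
have /dual_dot_gt0/dual_norm_gt0/dual_pos_unit nU := beta_regular _ Is.
have := orthogonal _ Is; rewrite dual_dotE dot3Zr => h.
have {}h : dot3 (T s) (dvec_deriv beta s) = 0.
  by apply: (mulrI (_ : (dual_norm (dvec_deriv beta s))^-1 \is a GRing.unit));
    rewrite ?unitrV // mulr0.
move: h; rewrite (vec_derivE _ _ _ (is_vec_deriv_beta _ Is)).
apply: coef_eqN1; first exact: (tangent_unit I).
exact: (tangent_dot_deriv I).
Qed.

Lemma involute_deriv1 s : I s -> dvec_deriv beta s = lambda s *: T1 s.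
Proof.
move=> Is; rewrite (vec_derivE _ _ _ (is_vec_deriv_beta _ Is)).
by rewrite lambda_deriv // scaleN1r addNKr.
Qed.

Let is_dual_deriv_lambda s : I s -> is_dual_deriv lambda s (-1).
Proof.
by move=> Is; rewrite -(lambda_deriv _ Is); apply: dual_differentiableP Is.
Qed.

Lemma involute_deriv2 s : I s ->
  dvec_deriv (dvec_deriv beta) s = - T1 s + lambda s *: T2 s.
Proof.
move=> Is; apply: vec_derivE; rewrite -scaleN1r.
apply: near_eq_is_vec_deriv (is_vec_derivZ _ _ _ _ _ (is_dual_deriv_lambda _ Is)
  (is_vec_deriv_T1 _ _ alpha_curve _ Is)).
by apply: filterS (near_open _ I_open _ Is) => t /involute_deriv1.
Qed.

Lemma involute_deriv3 s : I s ->
  dvec_deriv (dvec_deriv (dvec_deriv beta)) s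
  = - (T2 s *+ 2) + lambda s *: T3 s.
Proof.
move=> Is; apply: vec_derivE.
have h1 := is_vec_derivN _ _ _ (is_vec_deriv_T1 _ _ alpha_curve _ Is).
have h2 := is_vec_derivZ _ _ _ _ _ (is_dual_deriv_lambda _ Is)
  (is_vec_deriv_T2 _ _ alpha_curve _ Is).
rewrite mulr2n opprD -addrA -[X in _ + (X + _)]scaleN1r.
apply: near_eq_is_vec_deriv (is_vec_derivD _ _ _ _ _ h1 h2).
by apply: filterS (near_open _ I_open _ Is) => t /involute_deriv2.
Qed.

(** As β' = λT', a zero of the real part of λ would be a zero of the real part of β'. *)
Lemma dreal_lambda_neq0 s : I s -> dreal (lambda s) != 0.
Proof.
move=> Is; apply: contraNneq (beta_regular _ Is) => l0.
rewrite involute_deriv1 //; move: (T1 s) => v; apply/eqP/rowP => i.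
by rewrite 3!mxE drealM l0 mul0r.
Qed.

End Involute.

(** * Direction of the Darboux vector of the involute *)

Theorem theorem5 (R : realType) (I : set R)
    (alpha beta : R -> 'rV[dualnum R]_3) (tau Phi : R -> dualnum R)
    (I_open : open I) (I_interval : is_interval I)
    (alpha_curve : dual_curve I alpha)
    (alpha_unit_speed : unit_speed I alpha)
    (kappa_pos : forall s, I s -> 0 < dreal (frenet_kappa alpha s))
    (tau_torsion : is_torsion I alpha tau)
    (beta_involute : involute I alpha beta)
    (Phi_angle : is_dual_angle I alpha tau Phi) :
  forall s, I s ->
    let kappa := frenet_kappa alpha in
    let N := frenet_N alpha in
    let C := fun t => unit_dir (darboux alpha tau t) in
    let Cbar := fun t => unit_dir (gen_darboux beta t) in
    let Phi' := dual_deriv Phi in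
    Cbar s =
      (Phi' s / dual_sqrt (Phi' s ^+ 2 + kappa s ^+ 2 + tau s ^+ 2)) *: N s
      + (dual_sqrt (kappa s ^+ 2 + tau s ^+ 2)
         / dual_sqrt (Phi' s ^+ 2 + kappa s ^+ 2 + tau s ^+ 2)) *: C s.
Proof.
move=> s Is kappa N C Cbar Phi'.
have [beta_regular [lambda [lambda_diff betaE orthogonal]]] := beta_involute.
have NN : dot3 (N s) (N s) = 1 by exact: (normal_unit I).
have TT := tangent_unit _ _ alpha_unit_speed _ Is.
have TN : dot3 (frenet_T alpha s) (N s) = 0 by exact: (tangent_normal I).
have BE := binormalE alpha s.
have rr := dreal_kappa_tau_gt0 _ _ kappa_pos tau _ Is.
have d1E := involute_deriv1 _ _ _ I_open alpha_curve alpha_unit_speed _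
  beta_regular lambda_diff betaE orthogonal _ Is.
have d2E := involute_deriv2 _ _ _ I_open alpha_curve alpha_unit_speed _
  beta_regular lambda_diff betaE orthogonal _ Is.
have d3E := involute_deriv3 _ _ _ I_open alpha_curve alpha_unit_speed _
  beta_regular lambda_diff betaE orthogonal _ Is.
have l0 := dreal_lambda_neq0 _ _ _ I_open alpha_curve alpha_unit_speed _
  beta_regular lambda_diff betaE orthogonal _ Is.
have [crossE detE] := triple_lambda _ _ _ _ _ _ _ d1E d2E d3E.
have ht := dual_differentiableP _ _ _ (tau_differentiable _ _ I_open alpha_curve
  kappa_pos _ _ Phi_angle) Is.
(* With r the root of κ² + τ², only the two denominators are rewritten, to the form Φ'² + r²; the
   numerator stays r. *)
rewrite /Cbar /C -addrA -{1 3}(dual_sqr_sqrt _ rr).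
apply: (@unit_gen_darboux _ (N s) (darboux alpha tau s) _ _ _
  (lambda s * kappa s)).
- by rewrite drealM mulf_neq0 // gt_eqF // kappa_pos.
- exact: dreal_sqrt_gt0.
- exact: NN.
- exact: normal_dot_darboux.
- rewrite (dual_sqr_sqrt _ rr).
  exact: (darboux_dot_self _ _ _ _ _ TT NN TN BE).
- by rewrite d1E -scalerA; congr (_ *: _); rewrite (kappa_normal I).
- rewrite dual_crossE crossE exprMn -[RHS]scalerA; congr (_ *: _).
  exact: (cross_T1_T2 _ _ I_open alpha_curve alpha_unit_speed kappa_pos _
    tau_torsion).
(* The determinant is λ³ · κ³(κτ' - κ'τ), and the bracket equals r²Φ'. *)
- have tripleE := triple_T1_T2_T3 _ _ I_open alpha_curve alpha_unit_speed
    kappa_pos _ tau_torsion _ _ Is ht.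
  have angleE := angle_deriv _ _ I_open alpha_curve kappa_pos _ _ Phi_angle _ Is.
  by rewrite dual_detE detE tripleE angleE exprM_factor.
Qed.
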